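(* Let $T^4=\mathbb{R}^4/\mathbb{Z}^4$, let $G$ be a constant Riemannian metric and $B$ a constant real 2-form on $T^4$ with all components $G_{IJ},B_{IJ}\in\mathbb{Q}$ (i.e. the $\mathcal N=(1,1)$ SCFT for $(T^4;G,B)$ is rational). Let $I$ be a polarizable constant complex structure on $T^4$ with which $G$ is compatible, $M_I=(T^4,I)$, and $\omega$ the associated Kähler form. Then $\omega\in \mathcal H^2(M_I)\otimes_{\mathbb{Q}}\mathbb{R}$, where $\mathcal H^2(M_I)=H^2(T^4;\mathbb{Q})\cap H^{1,1}(M_I;\mathbb{R})$. Moreover, $i\omega\in \mathcal H^2(M_I)\otimes_{\mathbb{Q}} E$, where $E\subset\mathbb{C}$ is the reflex field described below.
   Context: Coordinates $X^1,\dots,X^4$ on $T^4$, normalized so that $H_1(T^4;\mathbb{Z})=\mathbb{Z}^4$ and $2\pi\sqrt{\alpha'}=1$; $G=G_{IJ}dX^I\otimes dX^J$, $B=\frac12B_{IJ}dX^I\wedge dX^J$. $G$ compatible with $I$ means $G(Iu,Iv)=G(u,v)$. Polarizable means some $\psi\in H^2(T^4;\mathbb{Z})\cap H^{1,1}(M_I)$ has $\psi(I\cdot,\cdot)$ positive definite. The Kähler form is $\omega=\frac12\omega_{IJ}dX^I\wedge dX^J$ with $\omega_{IJ}=I^K{}_I G_{KJ}$. Under these hypotheses $M_I$ is a CM abelian surface: $\mathrm{End}(H^1(M_I;\mathbb{Q}))^{\mathrm{Hdg}}$ (Hodge-structure-preserving $\mathbb{Q}$-endomorphisms) contains a commutative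 semisimple $\mathbb{Q}$-subalgebra $F$ of dimension 4 (a CM algebra). $F$ acts on the 2-dimensional space $H^{1,0}(M_I)$ diagonalizably through two ring homomorphisms $\varphi_1,\varphi_2:F\to\mathbb{C}$ (the CM type). The reflex field is $E:=\mathbb{Q}\big(\varphi_1(a)+\varphi_2(a)\,:\,a\in F\big)\subset\mathbb{C}$; equivalently, it is the image in $\mathbb{C}$ of the (CM) field $\mathrm{End}(T_{M_I}\otimes\mathbb{Q})^{\mathrm{Hdg}}$ through its action on $H^{2,0}(M_I)$, where $T_{M_I}\otimes\mathbb{Q}$ is the orthogonal complement of $\mathcal H^2(M_I)$ in $H^2(T^4;\mathbb{Q})$ with respect to $(\psi,\chi)\mapsto\int\psi\wedge\chi$. *)

(* Defs.v *)
From HB Require Import structures.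
From mathcomp Require Import all_boot all_order all_algebra.
From mathcomp Require Import perm.
From mathcomp Require Import reals.
From mathcomp Require Import complex.
Set Implicit Arguments. Unset Strict Implicit. Unset Printing Implicit Defensive.
Import Order.TTheory GRing.Theory Num.Theory.
Local Open Scope ring_scope.

(* Constant tensors on T^4 = R^4/Z^4 are 4x4 matrices in the coordinates
   X^1..X^4 (indices 0..3).  A 2-form psi = 1/2 psi_IJ dX^I/\dX^J is an
   antisymmetric matrix; a bilinear form b(u,v) = u^T b v.  The complex
   structure acts on column vectors: (I u)^K = I^K_J u^J, i.e. I K J = I^K_J. *)

Definition antisym {K : pzRingType} (A : 'M[K]_4) : Prop := A^T = - A.

Definition posdef {R : realType} (A : 'M[R]_4) : Prop :=
  A^T = A /\ forall u : 'cV[R]_4, u != 0 -> 0 < (u^T *m A *m u) 0 0.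

Definition ratR {R : realType} (A : 'M[rat]_4) : 'M[R]_4 := map_mx ratr A.
Definition intR {R : realType} (A : 'M[int]_4) : 'M[R]_4 :=
  map_mx (fun z : int => z%:~R) A.

Definition toC {R : realType} (x : R) : R[i] := Complex x 0.
Definition iC {R : realType} : R[i] := Complex 0 1.
Definition RC {R : realType} (A : 'M[R]_4) : 'M[R[i]]_4 := map_mx toC A.
Definition QC {R : realType} (A : 'M[rat]_4) : 'M[R[i]]_4 := map_mx (@ratr R[i]) A.

Definition cplx_struct {R : realType} (I : 'M[R]_4) : Prop := I *m I = - 1%:M.

Definition compatible {R : realType} (G I : 'M[R]_4) : Prop := I^T *m G *m I = G.

Definition is11 {R : realType} (I : 'M[R]_4) (psi : 'M[R]_4) : Prop :=
  I^T *m psi *m I = psi.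

(* Polarizable: some psi in H^2(T^4;Z) /\ H^{1,1}(M_I) with psi(I.,.) > 0.
   H^2(T^4;Z) = integral antisymmetric matrices. *)
Definition polarizable {R : realType} (I : 'M[R]_4) : Prop :=
  exists psi : 'M[int]_4, antisym psi /\ is11 I (intR psi) /\
    posdef ((I^T *m intR psi)).

Definition kahler {R : realType} (I G : 'M[R]_4) : 'M[R]_4 := I^T *m G.

Definition calH2 {R : realType} (I : 'M[R]_4) (psi : 'M[rat]_4) : Prop :=
  antisym psi /\ is11 I (ratR psi).

(* Complex 2-forms of Hodge type (2,0), (1,1), (0,2) w.r.t. I, with the
   convention that (1,0)-forms alpha satisfy alpha(I u) = i alpha(u). *)
Definition type20 {R : realType} (I : 'M[R]_4) (s : 'M[R[i]]_4) : Prop :=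
  antisym s /\ (RC I)^T *m s = iC *: s.
Definition type02 {R : realType} (I : 'M[R]_4) (s : 'M[R[i]]_4) : Prop :=
  antisym s /\ (RC I)^T *m s = - (iC *: s).
Definition type11 {R : realType} (I : 'M[R]_4) (s : 'M[R[i]]_4) : Prop :=
  antisym s /\ (RC I)^T *m s *m RC I = s.

(* the intersection pairing (psi,chi) |-> int psi /\ chi, up to the
   nonzero factor 4 (irrelevant for orthogonality) *)
Definition wedge_pair {K : comNzRingType} (psi chi : 'M[K]_4) : K :=
  \sum_(s : 'S_4) (-1) ^+ s * psi (s (inord 0)) (s (inord 1))
                           * chi (s (inord 2)) (s (inord 3)).

Definition transc {R : realType} (I : 'M[R]_4) (chi : 'M[rat]_4) : Prop :=
  antisym chi /\ forall psi, calH2 I psi -> wedge_pair psi chi = 0.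

Definition lincombC {R : realType} n (c : 'I_n -> R[i]) (chi : 'I_n -> 'M[rat]_4)
  : 'M[R[i]]_4 := \sum_(k < n) c k *: QC (chi k).

(* Hodge-structure preserving Q-endomorphisms of T_{M_I} (x) Q: a Q-linear
   map f preserving T_Q whose C-linear extension to T_C preserves each of
   the Hodge pieces H^{2,0}, H^{1,1}, H^{0,2} (intersected with T_C). *)
Definition hodge_endo {R : realType} (I : 'M[R]_4)
  (f : {linear 'M[rat]_4 -> 'M[rat]_4}) : Prop :=
  (forall chi, transc I chi -> transc I (f chi)) /\
  forall n (c : 'I_n -> R[i]) (chi : 'I_n -> 'M[rat]_4),
    (forall k, transc I (chi k)) ->
    (type20 I (lincombC c chi) -> type20 I (lincombC c (f \o chi))) /\
    (type11 I (lincombC c chi) -> type11 I (lincombC c (f \o chi))) /\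
    (type02 I (lincombC c chi) -> type02 I (lincombC c (f \o chi))).

(* Reflex field E subset C: the image of End(T_{M_I} (x) Q)^Hdg in C through
   its action on the line H^{2,0}(M_I) (which lies in T_C): lambda is in E iff
   some Hodge endomorphism f acts on a nonzero sigma in H^{2,0} /\ T_C by
   multiplication by lambda. *)
Definition reflex_field {R : realType} (I : 'M[R]_4) (lam : R[i]) : Prop :=
  exists f : {linear 'M[rat]_4 -> 'M[rat]_4}, hodge_endo I f /\
  exists n (c : 'I_n -> R[i]) (chi : 'I_n -> 'M[rat]_4),
    (forall k, transc I (chi k)) /\
    lincombC c chi != 0 /\ type20 I (lincombC c chi) /\
    lincombC c (f \o chi) = lam *: lincombC c chi.

(* Main.v *)
(** Put M = G^-1 psi, where psi is a polarization: M is rational, commutes with I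
    and is skew for G.  In a G-orthonormal basis adapted to I it is the product
    of I and a positive Hermitian 2x2 matrix, with eigenvalues mu_1, mu_2 say;
    let s = mu_1 + mu_2, p = mu_1 mu_2 and t = mu_1^2 + mu_2^2.  Then t and p^2
    are rational, s^2 = t + 2p, and s p I = (p + t) M + M^3 by Cayley-Hamilton.
    Multiplying by G shows that omega is a real combination of the rational
    (1,1)-forms psi = G M and G M^3.
    The derivation A |-> M^T A + A M of 2-forms is a Hodge endomorphism of the
    transcendental lattice, and it acts on the (2,0)-form as the trace i s of M on
    the (1,0)-part.  The coefficients of i omega are rational functions of i s
    with rational coefficients, so they lie in the reflex field. *)
Require Import Defs.
From HB Require Import structures.
From mathcomp Require Import all_boot all_order all_algebra.
From mathcomp Require Import perm.
From mathcomp Require Import reals.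
From mathcomp Require Import complex.
From mathcomp Require Import boolp ring lra.
Import Order.TTheory GRing.Theory Num.Theory.
Local Open Scope ring_scope.

(** * The intersection pairing in coordinates *)

(** A permutation of n+1 points amounts to the image of 0 and a permutation of the other n;
    iterating this unrolls a sum over S_4. *)
Lemma sum_perm_lift (V : nmodType) n (F : 'S_n.+1 -> V) :
  \sum_s F s = \sum_i \sum_(s : 'S_n) F (lift_perm ord0 i s).
Proof.
rewrite pair_bigA /= (reindex (fun p : 'I_n.+1 * 'S_n => lift_perm ord0 p.1 p.2)) //.
apply/onW_bij/inj_card_bij.
  move=> [i s] [j t] /= e.
  have eij : i = j by move/permP/(_ ord0): (e); rewrite !lift_perm_id.
  rewrite -{}eij in e *; congr pair; apply/permP => k.
  by move/permP/(_ (lift ord0 k)): e; rewrite !lift_perm_lift => /lift_inj.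
by rewrite card_prod !card_Sn card_ord factS.
Qed.

Definition o4 (k : nat) (hk : (k < 4)%N) : 'I_4 := Ordinal hk.
Notation o0 := (o4 0 isT).
Notation o1 := (o4 1 isT).
Notation o2 := (o4 2 isT).
Notation o3 := (o4 3 isT).

Lemma sum4 (V : nmodType) (F : 'I_4 -> V) :
  \sum_i F i = F o0 + F o1 + F o2 + F o3.
Proof.
rewrite !big_ord_recl big_ord0 addr0 !addrA.
by congr (F _ + F _ + F _ + F _); apply/val_inj.
Qed.

Lemma forall4 (P : 'I_4 -> Prop) : P o0 -> P o1 -> P o2 -> P o3 -> forall i, P i.
Proof.
move=> h0 h1 h2 h3 [[|[|[|[|m]]]] hm] //.
- by rewrite (_ : Ordinal hm = o0) //; apply: val_inj.
- by rewrite (_ : Ordinal hm = o1) //; apply: val_inj.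
- by rewrite (_ : Ordinal hm = o2) //; apply: val_inj.
- by rewrite (_ : Ordinal hm = o3) //; apply: val_inj.
Qed.

(** Laplace expansion along the first two slots: identities for the pairing become polynomial
    identities in the entries. *)
Lemma wedge_pair_expand (K : comNzRingType) (A B : 'M[K]_4) :
  wedge_pair A B =
    (A o0 o1 - A o1 o0) * (B o2 o3 - B o3 o2)
  - (A o0 o2 - A o2 o0) * (B o1 o3 - B o3 o1)
  + (A o0 o3 - A o3 o0) * (B o1 o2 - B o2 o1)
  + (A o1 o2 - A o2 o1) * (B o0 o3 - B o3 o0)
  - (A o1 o3 - A o3 o1) * (B o0 o2 - B o2 o0)
  + (A o2 o3 - A o3 o2) * (B o0 o1 - B o1 o0).
Proof.
have i0 : inord 0 = ord0 :> 'I_4 by apply/val_inj; rewrite /= inordK.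
have i1 : inord 1 = lift ord0 ord0 :> 'I_4 by apply/val_inj; rewrite /= inordK.
have i2 : inord 2 = lift ord0 (lift ord0 ord0) :> 'I_4.
  by apply/val_inj; rewrite /= inordK.
have i3 : inord 3 = lift ord0 (lift ord0 (lift ord0 ord0)) :> 'I_4.
  by apply/val_inj; rewrite /= inordK.
rewrite /wedge_pair i0 i1 i2 i3.
pose a m n := A (inord m) (inord n).
pose b m n := B (inord m) (inord n).
have Aa i j : A i j = a i j by rewrite /a !inord_val.
have Bb i j : B i j = b i j by rewrite /b !inord_val.
(* Summand of the permutation with successive images i, j, k, l; each [lift_perm] contributes one
   parity to the sign. *)
pose f (i : 'I_4) (j : 'I_3) (k : 'I_2) (l : 'I_1) : K :=
  (-1) ^+ (odd i (+) odd j (+) odd k (+) odd l : bool) *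
  a i (lift i j) * b (lift i (lift j k)) (lift i (lift j (lift k l))).
transitivity (\sum_i \sum_j \sum_k \sum_l f i j k l).
  rewrite sum_perm_lift; apply: eq_bigr => i _.
  rewrite sum_perm_lift; apply: eq_bigr => j _.
  rewrite sum_perm_lift; apply: eq_bigr => k _.
  rewrite sum_perm_lift; apply: eq_bigr => l _.
  rewrite (bigD1 (1%g : 'S_0)) //= big1 => [|s /eqP[]]; last by apply/permP => -[].
  rewrite addr0 !lift_perm_lift !lift_perm_id !odd_lift_perm odd_perm1 /= addbF.
  by rewrite /f !addbA -Aa -Bb.
rewrite !big_ord_recl !big_ord0 /f /= !Aa !Bb /= /bump /=.
ring.
Qed.

(** [M] acts on forms as a derivation, hence on top-degree forms as multiplication by its trace. *)
Lemma wedge_pair_derivation (K : comNzRingType) (M A B : 'M[K]_4) :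
  wedge_pair (M^T *m A + A *m M) B + wedge_pair A (M^T *m B + B *m M) =
  \tr M * wedge_pair A B.
Proof.
rewrite !wedge_pair_expand /mxtrace sum4 !mxE !sum4 !mxE.
ring.
Qed.

(** * Rational forms inside complex forms *)

HB.instance Definition _ (R : realType) :=
  GRing.RMorphism.copy (@toC R) (real_complex R).

Lemma mulr_iC (R : realType) : iC * iC = -1 :> R[i].
Proof. exact: sqr_i. Qed.

Lemma QC_ratR (R : realType) (A : 'M[rat]_4) : QC A = RC (@ratR R A).
Proof. by apply/matrixP => i j; rewrite !mxE fmorph_rat. Qed.

HB.instance Definition _ (R : realType) :=
  GRing.Additive.copy (@QC R) (map_mx (@ratr R[i])).
HB.instance Definition _ (R : realType) :=
  GRing.Additive.copy (@RC R) (map_mx (@toC R)).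
HB.instance Definition _ (R : realType) :=
  GRing.Additive.copy (@ratR R) (map_mx (@ratr R)).

Lemma QC_M (R : realType) (A B : 'M[rat]_4) : QC (A *m B) = QC A *m QC B :> 'M[R[i]]_4.
Proof. exact: map_mxM. Qed.
Lemma QC_T (R : realType) (A : 'M[rat]_4) : QC A^T = (QC A)^T :> 'M[R[i]]_4.
Proof. by rewrite /QC map_trmx. Qed.
Lemma QC_Z (R : realType) (a : rat) (A : 'M[rat]_4) :
  QC (a *: A) = ratr a *: QC A :> 'M[R[i]]_4.
Proof. exact: map_mxZ. Qed.
Lemma RC_M (R : realType) (A B : 'M[R]_4) : RC (A *m B) = RC A *m RC B.
Proof. exact: map_mxM. Qed.
Lemma RC_T (R : realType) (A : 'M[R]_4) : RC A^T = (RC A)^T.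
Proof. by rewrite /RC map_trmx. Qed.
Lemma RC_Z (R : realType) (a : R) (A : 'M[R]_4) : RC (a *: A) = toC a *: RC A.
Proof. exact: map_mxZ. Qed.
Lemma ratR_M (R : realType) (A B : 'M[rat]_4) : ratR (A *m B) = ratR A *m ratR B :> 'M[R]_4.
Proof. exact: map_mxM. Qed.
Lemma ratR_T (R : realType) (A : 'M[rat]_4) : ratR A^T = (ratR A)^T :> 'M[R]_4.
Proof. by rewrite /ratR map_trmx. Qed.

Definition qfree {K : fieldType} {n} (c : 'I_n -> K) :=
  forall r : 'I_n -> rat, \sum_k ratr (r k) * c k = 0 -> forall k, r k = 0.

(** Induction on the number of terms: a nontrivial rational relation expresses one coefficient
    through the others, and its form is absorbed into theirs. *)
Lemma lincombC_qfree (R : realType) n (c : 'I_n -> R[i]) (chi : 'I_n -> 'M[rat]_4) :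
  exists m (c' : 'I_m -> R[i]) (chi' : 'I_m -> 'M[rat]_4),
    qfree c' /\ lincombC c' chi' = lincombC c chi.
Proof.
elim: n c chi => [|n IH] c chi.
  by exists 0%N, c, chi; split=> // r _ [].
have [free|] := EM (qfree c); first by exists n.+1, c, chi.
move=> /existsNP[r /not_implyP[rc /existsNP[k /eqP rk0]]].
have [m [c' [chi' [free eqc]]]] := IH (fun j => c (lift k j))
  (fun j => chi (lift k j) - (r (lift k j) / r k) *: chi k).
exists m, c', chi'; split=> //; rewrite {}eqc /lincombC.
rewrite [RHS](bigD1_ord k) //=.
have ck : c k = - \sum_j ratr (r (lift k j) / r k) * c (lift k j).
  have rk0' : (ratr (r k) : R[i]) != 0 by rewrite fmorph_eq0.
  apply: (mulfI rk0'); rewrite mulrN mulr_sumr.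
  apply/eqP; rewrite -addr_eq0 -[X in _ == X]rc (bigD1_ord k) //=; apply/eqP.
  congr (_ + _); apply: eq_bigr => j _.
  by rewrite fmorph_div mulrA mulrCA divff // mulr1.
rewrite ck scaleNr scaler_suml addrC -sumrB; apply: eq_bigr => j _.
by rewrite raddfB /= QC_Z scalerBr scalerA (mulrC (c _)).
Qed.

Lemma mx_lincombC (R : realType) (S : 'M[R[i]]_4) :
  exists n (c : 'I_n -> R[i]) (chi : 'I_n -> 'M[rat]_4), S = lincombC c chi.
Proof.
pose T := ('I_4 * 'I_4)%type.
exists #|{: T}|, (fun k => S (enum_val k).1 (enum_val k).2),
  (fun k => delta_mx (enum_val k).1 (enum_val k).2).
rewrite /lincombC -(big_enum_val (fun p : T => S p.1 p.2 *: QC (delta_mx p.1 p.2))) /=.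
rewrite [LHS]matrix_sum_delta pair_bigA /=; apply: eq_bigr => -[i j] _ /=.
by rewrite /QC map_delta_mx.
Qed.

Lemma wedge_pair_lincombC (R : realType) n (c : 'I_n -> R[i]) (chi : 'I_n -> 'M[rat]_4) psi :
  wedge_pair (QC psi) (lincombC c chi) = \sum_k ratr (wedge_pair psi (chi k)) * c k.
Proof.
rewrite /wedge_pair /lincombC.
under [RHS]eq_bigr do rewrite raddf_sum /= mulr_suml.
rewrite exchange_big /=; apply: eq_bigr => s _.
rewrite summxE mulr_sumr; apply: eq_bigr => k _.
by rewrite !mxE !rmorphM /= rmorph_sign (mulrC (c k)) mulrA.
Qed.

(* Pairing with a rational form gives a rational relation among the
   coefficients, so every component of a Q-free expansion is transcendental. *)
Lemma transc_lincombC (R : realType) (I : 'M[R]_4) (S : 'M[R[i]]_4) :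
  antisym S -> (forall psi, calH2 I psi -> wedge_pair (QC psi) S = 0) ->
  exists n (c : 'I_n -> R[i]) (chi : 'I_n -> 'M[rat]_4),
    (forall k, transc I (chi k)) /\ lincombC c chi = S.
Proof.
have [n0 [c0 [chi0 ->]]] := mx_lincombC _ S.
have [n [c [chi [free <-]]]] := lincombC_qfree _ _ c0 chi0.
move=> asS orth; exists n, c, chi; split=> // k; split.
  (* Antisymmetry of the sum is, entry by entry, also a rational relation among the coefficients. *)
  apply/matrixP => i j; rewrite !mxE; apply/eqP; rewrite -addr_eq0; apply/eqP.
  move: k; apply: free; move/matrixP/(_ i j)/eqP: asS.
  rewrite !mxE !summxE -addr_eq0 -big_split /= => /eqP e; rewrite -[RHS]e.
  by apply: eq_bigr => k _; rewrite !mxE rmorphD mulrDl ![ratr _ * _]mulrC.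
move=> psi /orth; rewrite wedge_pair_lincombC => /free; exact.
Qed.

(** * Hodge endomorphisms and their eigenvalues *)

(** The infinitesimal pullback of the form [A] along [M]: the derivative at r = 0 of exp(rM)^T A
    exp(rM). *)
Definition lie {K : pzRingType} (M A : 'M[K]_4) : 'M[K]_4 := M^T *m A + A *m M.

Lemma lie_is_linear (K : comPzRingType) (M : 'M[K]_4) : linear (lie M).
Proof.
move=> a A B; rewrite /lie mulmxDr mulmxDl -scalemxAr -scalemxAl scalerDr.
by rewrite addrACA.
Qed.

HB.instance Definition _ (K : comPzRingType) (M : 'M[K]_4) :=
  GRing.isLinear.Build K 'M[K]_4 'M[K]_4 _ (lie M) (lie_is_linear K M).

Lemma lie_antisym (K : comPzRingType) (M A : 'M[K]_4) : antisym A -> antisym (lie M A).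
Proof.
rewrite /antisym /lie => aA.
by rewrite linearD /= !trmx_mul trmxK aA mulmxN mulNmx -opprD addrC.
Qed.

Lemma lie_left_eigen (K : comPzRingType) (I M A : 'M[K]_4) z :
  I *m M = M *m I -> I^T *m A = z *: A -> I^T *m lie M A = z *: lie M A.
Proof.
move=> cIM eA; have cT : I^T *m M^T = M^T *m I^T by rewrite -!trmx_mul cIM.
by rewrite /lie mulmxDr !mulmxA cT -mulmxA eA -scalemxAr -scalemxAl scalerDr.
Qed.

Lemma lie_invariant (K : comPzRingType) (I M A : 'M[K]_4) :
  I *m M = M *m I -> I^T *m A *m I = A -> I^T *m lie M A *m I = lie M A.
Proof.
move=> cIM eA; have cT : I^T *m M^T = M^T *m I^T by rewrite -!trmx_mul cIM.
rewrite /lie mulmxDr mulmxDl !mulmxA cT -!mulmxA -cIM.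
by rewrite (mulmxA _ A I) eA !mulmxA eA.
Qed.

Lemma lincombC_add (R : realType) n (c : 'I_n -> R[i]) (f g : 'I_n -> 'M[rat]_4) :
  lincombC c (f \+ g) = lincombC c f + lincombC c g.
Proof. by rewrite /lincombC -big_split; apply: eq_bigr => k _; rewrite /= raddfD scalerDr. Qed.

Lemma lincombC_scale (R : realType) n (c : 'I_n -> R[i]) (a : rat) (f : 'I_n -> 'M[rat]_4) :
  lincombC c (a \*: f) = ratr a *: lincombC c f.
Proof.
rewrite /lincombC scaler_sumr; apply: eq_bigr => k _.
by rewrite /= QC_Z !scalerA mulrC.
Qed.

Lemma lincombC_lie (R : realType) n (c : 'I_n -> R[i]) (M : 'M[rat]_4)
    (f : 'I_n -> 'M[rat]_4) :
  lincombC c (lie M \o f) = lie (QC M) (lincombC c f).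
Proof.
rewrite /lincombC linear_sum; apply: eq_bigr => k _ /=.
by rewrite linearZ /= /lie raddfD /= !QC_M QC_T.
Qed.

(** * Linearity of the pairing and stability of the Hodge types *)

Lemma wedge_pair_linear (K : comNzRingType) (A : 'M[K]_4) : scalar (wedge_pair A).
Proof. by move=> a B C; rewrite !wedge_pair_expand !mxE; ring. Qed.

Lemma antisym_linear (K : comPzRingType) (a : K) (A B : 'M[K]_4) :
  antisym A -> antisym B -> antisym (a *: A + B).
Proof. by rewrite /antisym linearP /= => -> ->; rewrite scalerN opprD. Qed.

Lemma antisymZ (K : comPzRingType) (a : K) (A : 'M[K]_4) : antisym A -> antisym (a *: A).
Proof. by rewrite /antisym linearZ /= => ->; rewrite scalerN. Qed.

Lemma antisymD (K : comPzRingType) (A B : 'M[K]_4) :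
  antisym A -> antisym B -> antisym (A + B).
Proof. by rewrite /antisym linearD /= => -> ->; rewrite opprD. Qed.

Lemma transc_linear (R : realType) (I : 'M[R]_4) a A B :
  transc I A -> transc I B -> transc I (a *: A + B).
Proof.
move=> [aA oA] [aB oB]; split; first exact: antisym_linear.
by move=> psi h; rewrite wedge_pair_linear oA ?oB // mulr0 addr0.
Qed.

Lemma transcZ (R : realType) (I : 'M[R]_4) a A : transc I A -> transc I (a *: A).
Proof.
move=> tA; rewrite -[_ *: _]addr0; apply: transc_linear => //.
by have := transc_linear _ I (-1) A A tA tA; rewrite scaleN1r addNr.
Qed.

Lemma transcD (R : realType) (I : 'M[R]_4) A B : transc I A -> transc I B -> transc I (A + B).
Proof. by move=> tA tB; rewrite -(scale1r A); apply: transc_linear. Qed.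

Lemma type20D (R : realType) (I : 'M[R]_4) A B : type20 I A -> type20 I B -> type20 I (A + B).
Proof.
by move=> [aA hA] [aB hB]; split; [exact: antisymD | rewrite mulmxDr hA hB scalerDr].
Qed.

Lemma type02D (R : realType) (I : 'M[R]_4) A B : type02 I A -> type02 I B -> type02 I (A + B).
Proof.
by move=> [aA hA] [aB hB]; split; [exact: antisymD | rewrite mulmxDr hA hB scalerDr opprD].
Qed.

Lemma type11D (R : realType) (I : 'M[R]_4) A B : type11 I A -> type11 I B -> type11 I (A + B).
Proof.
by move=> [aA hA] [aB hB]; split; [exact: antisymD | rewrite mulmxDr mulmxDl hA hB].
Qed.

Lemma type20Z (R : realType) (I : 'M[R]_4) a A : type20 I A -> type20 I (a *: A).
Proof.
by move=> [aA hA]; split; [exact: antisymZ | rewrite -scalemxAr hA !scalerA mulrC].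
Qed.

Lemma type02Z (R : realType) (I : 'M[R]_4) a A : type02 I A -> type02 I (a *: A).
Proof.
move=> [aA hA]; split; first exact: antisymZ.
by rewrite -scalemxAr hA scalerN !scalerA mulrC.
Qed.

Lemma type11Z (R : realType) (I : 'M[R]_4) a A : type11 I A -> type11 I (a *: A).
Proof.
by move=> [aA hA]; split; [exact: antisymZ | rewrite -scalemxAr -scalemxAl hA].
Qed.

(** * The ring of eigenvalues of Hodge endomorphisms on one form *)

Section EigenvaluesOnCombination.
Variables (R : realType) (I : 'M[R]_4) (n : nat).
Variables (c : 'I_n -> R[i]) (chi : 'I_n -> 'M[rat]_4).
Implicit Types f g : {linear 'M[rat]_4 -> 'M[rat]_4}.

Lemma hodge_endo_comp f g : hodge_endo I f -> hodge_endo I g -> hodge_endo I (f \o g).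
Proof.
move=> [tf hf] [tg hg]; split=> [x /tg /tf //|m d x tx].
have [hg1 [hg2 hg3]] := hg m d x tx.
have [hf1 [hf2 hf3]] := hf m d (g \o x) (fun k => tg _ (tx k)).
by split; [move=> /hg1 /hf1 | split; [move=> /hg2 /hf2 | move=> /hg3 /hf3]].
Qed.

Lemma hodge_endo_add f g : hodge_endo I f -> hodge_endo I g -> hodge_endo I (f \+ g).
Proof.
move=> [tf hf] [tg hg]; split=> [x tx|m d x tx].
  by apply: transcD; [exact: tf | exact: tg].
have [hg1 [hg2 hg3]] := hg m d x tx; have [hf1 [hf2 hf3]] := hf m d x tx.
have -> : lincombC d ((f \+ g) \o x) = lincombC d (f \o x) + lincombC d (g \o x).
  by rewrite -lincombC_add.
split=> [h|]; first by apply: type20D; [exact: hf1 | exact: hg1].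
split=> h; first by apply: type11D; [exact: hf2 | exact: hg2].
by apply: type02D; [exact: hf3 | exact: hg3].
Qed.

Lemma hodge_endo_scale (a : rat) : hodge_endo I (a \*: idfun).
Proof.
split=> [x tx|m d x tx]; first exact: transcZ.
have -> : lincombC d ((a \*: idfun) \o x) = ratr a *: lincombC d x.
  by rewrite -lincombC_scale.
split; first exact: type20Z.
by split; [exact: type11Z | exact: type02Z].
Qed.

(** The expansion of the form is fixed, so that eigenvalues of different endomorphisms can be added
    and multiplied; [reflex_field] quantifies over expansions. *)
Definition hodge_eigenvalue (lam : R[i]) : Prop :=
  exists f, hodge_endo I f /\ lincombC c (f \o chi) = lam *: lincombC c chi.

Hypothesis transc_chi : forall k, transc I (chi k).

Lemma hodge_eigenvalueD x y :
  hodge_eigenvalue x -> hodge_eigenvalue y -> hodge_eigenvalue (x + y).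
Proof.
move=> [f [hf ef]] [g [hg eg]]; exists (f \+ g); split; first exact: hodge_endo_add.
by rewrite scalerDl -ef -eg -lincombC_add.
Qed.

Lemma hodge_eigenvalue_rat (a : rat) : hodge_eigenvalue (ratr a).
Proof.
exists (a \*: idfun); split; first exact: hodge_endo_scale.
by rewrite -lincombC_scale.
Qed.

(** The C-linear extension of [f], written on matrix units. *)
Definition complexify f (S : 'M[R[i]]_4) : 'M[R[i]]_4 :=
  \sum_i \sum_j S i j *: QC (f (delta_mx i j)).

(** Applying [f] termwise thus depends only on the sum and not on its expansion, which allows
    composing two eigenvector equations. *)
Lemma lincombC_complexify f m (d : 'I_m -> R[i]) x :
  lincombC d (f \o x) = complexify f (lincombC d x).
Proof.
rewrite /complexify /lincombC; under [RHS]eq_bigr => i _.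
  under eq_bigr do rewrite summxE scaler_suml.
  rewrite exchange_big; over.
rewrite exchange_big; apply: eq_bigr => k _ /=.
rewrite {1}[x k]matrix_sum_delta linear_sum raddf_sum scaler_sumr.
apply: eq_bigr => i _; rewrite linear_sum raddf_sum scaler_sumr.
by apply: eq_bigr => j _; rewrite linearZ /= QC_Z scalerA !mxE.
Qed.

Lemma complexifyZ f a S : complexify f (a *: S) = a *: complexify f S.
Proof.
rewrite scaler_sumr; apply: eq_bigr => i _; rewrite scaler_sumr.
by apply: eq_bigr => j _; rewrite mxE scalerA.
Qed.

Lemma hodge_eigenvalueM x y :
  hodge_eigenvalue x -> hodge_eigenvalue y -> hodge_eigenvalue (x * y).
Proof.
move=> [f [hf ef]] [g [hg eg]]; exists (f \o g); split; first exact: hodge_endo_comp.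
rewrite -[lincombC _ _]/(lincombC c (f \o (g \o chi))) lincombC_complexify eg.
by rewrite complexifyZ -lincombC_complexify ef scalerA mulrC.
Qed.

End EigenvaluesOnCombination.

(** By the derivation identity a traceless [M] makes [lie M] skew for the pairing; as it preserves
    the rational (1,1)-classes, it preserves their orthogonal complement. *)
Lemma transc_lie (R : realType) (I : 'M[R]_4) (M chi : 'M[rat]_4) :
  I *m ratR M = ratR M *m I -> \tr M = 0 -> transc I chi -> transc I (lie M chi).
Proof.
move=> cIM trM [aX oX]; split=> [|psi [aP hP]]; first exact: lie_antisym.
have := wedge_pair_derivation _ M psi chi.
rewrite trM mul0r -/(lie M psi) -/(lie M chi) oX ?add0r //; split.
  exact: lie_antisym.
have -> : ratR (lie M psi) = lie (ratR M) (@ratR R psi).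
  by rewrite /lie raddfD /= !ratR_M ratR_T.
exact: lie_invariant.
Qed.

Lemma hodge_endo_lie (R : realType) (I : 'M[R]_4) (M : 'M[rat]_4) :
  I *m ratR M = ratR M *m I -> \tr M = 0 -> hodge_endo I (lie M).
Proof.
move=> cIM trM; split=> [chi|n c chi _]; first exact: transc_lie.
have cC : RC I *m QC M = QC M *m RC I by rewrite QC_ratR -!RC_M cIM.
rewrite !lincombC_lie; split=> [[aS hS]|].
  by split; [exact: lie_antisym | exact: lie_left_eigen].
split=> [[aS hS]|[aS]]; first by split; [exact: lie_antisym | exact: lie_invariant].
rewrite -scaleNr => hS; split; first exact: lie_antisym.
by rewrite -scaleNr; exact: lie_left_eigen.
Qed.

(** [S] is closed only under ring operations, so each inverse is exhibited as a polynomial in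
    [alpha] with rational coefficients. *)
Lemma closed_inverses (K : numFieldType) (S : K -> Prop) (alpha p : K) (t q : rat) :
  (forall x y, S x -> S y -> S (x + y)) -> (forall x y, S x -> S y -> S (x * y)) ->
  (forall a, S (ratr a)) -> S alpha -> alpha != 0 -> p != 0 ->
  p ^+ 2 = ratr q -> alpha ^+ 2 = - (ratr t + 2 * p) ->
  S alpha^-1 /\ S (alpha * p)^-1.
Proof.
move=> SD SM SQ Sa a0 p0 pq a2.
have SN x : S x -> S (- x).
  by move=> Sx; rewrite -mulN1r; apply: SM => //; have := SQ (-1); rewrite rmorphN1.
have S2n : S 2 by have := SQ 2; rewrite rmorph_nat.
have S2 : S 2^-1 by have := SQ 2^-1; rewrite fmorphV rmorph_nat.
have Sp : S p.
  have -> : p = 2^-1 * (- (alpha * alpha) + - ratr t) by rewrite -expr2 a2; field.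
  by apply: (SM _ _ S2); apply: SD; apply: SN; [apply: SM | apply: SQ].
have SpV : S p^-1.
  have qV : ratr q^-1 = (p ^+ 2)^-1 by rewrite pq; exact: fmorphV.
  have -> : p^-1 = p * ratr q^-1 by rewrite qV; field.
  exact: SM.
have Sa2V : S (alpha ^+ 2)^-1.
  (* Multiply by the conjugate: (t + 2p)(t - 2p) = t^2 - 4q is rational. If t - 2p vanishes, alpha^2
     = -2t is itself rational. *)
  have [e|ne] := eqVneq (ratr t) (2 * p).
    have -> : (alpha ^+ 2)^-1 = ratr (- (2 * t))^-1.
      by rewrite fmorphV rmorphN rmorphM rmorph_nat /= a2 -e; congr (_^-1); ring.
    exact: SQ.
  have -> : (alpha ^+ 2)^-1 = - (ratr t + - (2 * p)) * ratr (t ^+ 2 - 4 * q)^-1.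
    have := a0; rewrite -sqrf_eq0 a2 oppr_eq0 => h.
    have -> : ratr (t ^+ 2 - 4 * q)^-1 = (ratr t ^+ 2 - 4 * p ^+ 2)^-1 :> K.
      by rewrite [LHS]fmorphV rmorphB rmorphXn rmorphM rmorph_nat pq.
    have ne' : ratr t - 2 * p != 0 :> K by rewrite subr_eq0.
    have -> : ratr t ^+ 2 - 4 * p ^+ 2 = (ratr t - 2 * p) * (ratr t + 2 * p) by ring.
    by field; rewrite ne' h.
  by apply: (SM) => //; apply/SN/SD => //; apply/SN/(SM _ _ S2n).

have SaV : S alpha^-1.
  have -> : alpha^-1 = alpha * (alpha ^+ 2)^-1 by field.
  exact: SM.
by split=> //; rewrite invfM; apply: SM.
Qed.

(** * The model rotation of C^2 *)

Definition mk4 {K : pzRingType} (s : seq (seq K)) : 'M[K]_4 :=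
  \matrix_(i, j) nth 0 (nth [::] s i) j.

Definition J4 {K : pzRingType} : 'M[K]_4 :=
  mk4 [:: [:: 0; -1; 0; 0]; [:: 1; 0; 0; 0]; [:: 0; 0; 0; -1]; [:: 0; 0; 1; 0]].

(* [J4] times the Hermitian matrix [[a, x - iy], [x + iy, b]]. *)
Definition psi0 {K : pzRingType} (a b x y : K) : 'M[K]_4 :=
  mk4 [:: [:: 0; - a; y; - x]; [:: a; 0; x; y]; [:: - y; - x; 0; - b]; [:: x; - y; b; 0]].

(* The holomorphic 2-form dz_1 /\ dz_2 of C^2, with [j] in the role of i. *)
Definition sigma0 {K : pzRingType} (j : K) : 'M[K]_4 :=
  mk4 [:: [:: 0; 0; 1; j]; [:: 0; 0; j; -1]; [:: -1; - j; 0; 0]; [:: - j; 1; 0; 0]].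

Ltac mx4 := apply/matrixP; do 2!(apply: forall4); rewrite !(mxE, sum4) /=.

(** With [psi0] = J h, where h is Hermitian and commutes with J, the square is -h^2 = p - s h by
    Cayley-Hamilton. *)
Lemma psi0_sqr (K : comPzRingType) (a b x y : K) :
  let s := a + b in let p := a * b - x ^+ 2 - y ^+ 2 in
  psi0 a b x y *m psi0 a b x y =
    mk4 [:: [:: p - s * a; 0; - (s * x); - (s * y)];
            [:: 0; p - s * a; s * y; - (s * x)];
            [:: - (s * x); s * y; p - s * b; 0];
            [:: - (s * y); - (s * x); 0; p - s * b]].
Proof. by mx4; ring. Qed.

(** From h^2 = s h - p follows (J h)^3 = -J h^3 = s p J - (s^2 - p) J h, and s^2 - p = p + t. *)
Lemma psi0_cubic (K : comPzRingType) (a b x y : K) :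
  let s := a + b in let p := a * b - x ^+ 2 - y ^+ 2 in let t := s ^+ 2 - 2 * p in
  (s * p) *: J4 = (p + t) *: psi0 a b x y
                  + psi0 a b x y *m psi0 a b x y *m psi0 a b x y.
Proof. by rewrite psi0_sqr; mx4; ring. Qed.

(** Over the reals the eigenvalues are +-i mu_1 and +-i mu_2, so this trace and that of the fourth
    power are power sums in mu_1^2, mu_2^2; they will give the rationality of t and p^2. *)
Lemma psi0_tr2 (K : comPzRingType) (a b x y : K) :
  let s := a + b in let p := a * b - x ^+ 2 - y ^+ 2 in let t := s ^+ 2 - 2 * p in
  \tr (psi0 a b x y *m psi0 a b x y) = - (2 * t).
Proof. by rewrite psi0_sqr /mxtrace sum4 !(mxE, sum4) /=; ring. Qed.

Lemma psi0_tr4 (K : comPzRingType) (a b x y : K) :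
  let s := a + b in let p := a * b - x ^+ 2 - y ^+ 2 in let t := s ^+ 2 - 2 * p in
  \tr (psi0 a b x y *m psi0 a b x y *m (psi0 a b x y *m psi0 a b x y)) =
    2 * t ^+ 2 - 4 * p ^+ 2.
Proof. by rewrite psi0_sqr /mxtrace sum4 !(mxE, sum4) /=; ring. Qed.

(** A C-linear map acts infinitesimally on dz_1 /\ dz_2 by its complex trace, here that of j h. *)
Lemma lie_psi0_sigma0 (K : comPzRingType) (a b x y j : K) : j * j = -1 ->
  lie (psi0 a b x y) (sigma0 j) = (j * (a + b)) *: sigma0 j.
Proof. by move=> j2; mx4; ring: j2. Qed.

Lemma sigma0_antisym (K : comPzRingType) (j : K) : antisym (sigma0 j).
Proof. by rewrite /antisym; mx4; ring. Qed.

Lemma sigma0_type (K : comPzRingType) (j : K) : j * j = -1 ->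
  J4^T *m sigma0 j = j *: sigma0 j.
Proof. by move=> j2; mx4; ring: j2. Qed.

Lemma psi0P (K : realDomainType) (A : 'M[K]_4) :
  antisym A -> J4^T *m A *m J4 = A -> exists a b x y, A = psi0 a b x y.
Proof.
rewrite /antisym => eA eI.
have aA i j : A^T i j = (- A) i j by rewrite eA.
have hA i j : (J4^T *m A *m J4) i j = A i j by rewrite eI.
(* The positions where [psi0] shows its four parameters; antisymmetry and two entries of the
   invariance equation determine the rest. *)
exists (A o1 o0), (A o3 o2), (A o1 o2), (A o0 o2).
have a i j : A j i = - A i j by have := aA i j; rewrite !mxE.
have d i : A i i = 0 by have := a i i; lra.
have h02 := hA o0 o2; have h03 := hA o0 o3.
rewrite !(mxE, sum4) /= in h02 h03.
have := a o0 o1; have := a o0 o2; have := a o0 o3; have := a o1 o2.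
have := a o1 o3; have := a o2 o3.
by move=> *; mx4; rewrite ?d; lra.
Qed.

Lemma J4_psi0 (K : comPzRingType) (a b x y : K) :
  J4^T *m psi0 a b x y =
    mk4 [:: [:: a; 0; x; y]; [:: 0; a; - y; x]; [:: x; - y; b; 0]; [:: y; x; 0; b]].
Proof. by mx4; ring. Qed.

(** J^T [psi0] is the real form of h, and a positive Hermitian 2x2 matrix has positive trace and
    determinant. *)
Lemma psi0_posdef (R : realType) (a b x y : R) :
  posdef (J4^T *m psi0 a b x y) -> 0 < a + b /\ 0 < a * b - x ^+ 2 - y ^+ 2.
Proof.
rewrite J4_psi0 => -[_ pos].
have a0 : 0 < a.
  have /pos : \col_i nth 0 [:: 1; 0; 0; 0] i != 0 :> 'cV[R]_4.
    by apply/eqP => /matrixP/(_ o0 0); rewrite !mxE /= => /eqP; rewrite oner_eq0.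
  by rewrite !(mxE, sum4) /=; lra.
have : 0 < a * (a * b - x ^+ 2 - y ^+ 2).
  (* Real coordinates of the vector (-(x - iy), a), which h sends to (0, det h); the form takes the
     value a det h there. *)
  have /pos : \col_i nth 0 [:: - x; y; a; 0] i != 0 :> 'cV[R]_4.
    by apply/eqP => /matrixP/(_ o2 0); rewrite !mxE /=; lra.
  by rewrite !(mxE, sum4) /=; lra.
rewrite pmulr_rgt0 // => p0; split=> //.
have : 0 < a * b by nra.
by rewrite pmulr_rgt0 // => b0; lra.
Qed.

(** * Bases adapted to a Hermitian metric *)

Lemma col_mul (K : pzSemiRingType) m n p (j : 'I_p) (A : 'M[K]_(m, n)) (B : 'M[K]_(n, p)) :
  col j (A *m B) = A *m col j B.
Proof. by rewrite !colE mulmxA. Qed.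

Lemma orthogonal_col (K : fieldType) (W : 'M[K]_(4, 1 + 1)) :
  exists2 v : 'cV[K]_4, v != 0 & v^T *m W = 0.
Proof.
have : kermx W != 0.
  rewrite -mxrank_eq0 mxrank_ker -lt0n subn_gt0.
  exact: leq_ltn_trans (rank_leq_col W) _.
case/rowV0Pn => v /sub_kermxP vW v0; exists v^T; last by rewrite trmxK.
by apply: contraNneq v0 => /(congr1 trmx); rewrite trmxK trmx0 => ->.
Qed.

(** Unitary Gram-Schmidt: take a unit vector u, then a unit vector v orthogonal to u and I u; the
    isometry I makes u, I u, v, I v orthonormal. *)
Lemma adapted_basis (R : realType) (G I : 'M[R]_4) :
  posdef G -> cplx_struct I -> compatible G I ->
  exists P : 'M[R]_4, P^T *m G *m P = 1%:M /\ I *m P = P *m J4.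
Proof.
move=> [sG pG] hI cG.
pose g (u v : 'cV[R]_4) := (u^T *m G *m v) 0 0.
have gC u v : g u v = g v u.
  have e : v^T *m G *m u = (u^T *m G *m v)^T by rewrite !trmx_mul trmxK sG mulmxA.
  by rewrite /g e [RHS]mxE.
have gI u v : g (I *m u) (I *m v) = g u v.
  by rewrite /g trmx_mul -!mulmxA (mulmxA G) (mulmxA I^T) (mulmxA I^T G) cG.
have II (u : 'cV[R]_4) : I *m (I *m u) = - u by rewrite mulmxA hI mulNmx mul1mx.
have gN u v : g u (- v) = - g u v by rewrite /g mulmxN mxE.
have gZ a b u v : g (a *: u) (b *: v) = a * b * g u v.
  by rewrite /g -scalemxAr [(a *: u)^T]linearZ /= -!scalemxAl !mxE mulrCA mulrA.
(* An isometry with square -1 is skew for g, whence g(u, I u) = 0. *)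
have gIr u v : g u (I *m v) = - g (I *m u) v.
  by rewrite -gI II gN.
have gII u : g u (I *m u) = 0 by have := gIr u u; rewrite (gC (I *m u)); lra.
have gIl u v : g (I *m u) v = - g u (I *m v) by rewrite gIr opprK.
have normalize v : v != 0 -> exists2 c, c != 0 & g (c *: v) (c *: v) = 1.
  move=> v0; have gv : 0 < g v v by exact: pG.
  exists (Num.sqrt (g v v))^-1; first by rewrite invr_eq0 sqrtr_eq0 -ltNge.
  rewrite gZ -invfM -expr2 sqr_sqrtr ?ltW // mulVf //; exact: lt0r_neq0.
have u0 : \col_i nth 0 [:: 1; 0; 0; 0] i != 0 :> 'cV[R]_4.
  by apply/eqP => /matrixP/(_ o0 0); rewrite !mxE /= => /eqP; rewrite oner_eq0.
have [c _] := normalize _ u0; set u := c *: _ => gu {u0}.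
have [w w0 ow] := orthogonal_col _ (row_mx (G *m u) (G *m (I *m u))).
have [d _] := normalize _ w0; set v := d *: w => gv.
move: ow; rewrite mul_mx_row -[0]row_mx0 => /eq_row_mx[ow1 ow2].
have gwl x : w^T *m (G *m x) = 0 -> g v x = 0.
  by move=> e; rewrite /g /v [(_ *: _)^T]linearZ /= -!scalemxAl -mulmxA e scaler0 mxE.
have gvu := gwl _ ow1; have gvIu := gwl _ ow2.
have guv : g u v = 0 by rewrite gC.
have gIuv : g (I *m u) v = 0 by rewrite gC.
have gII' x : g (I *m x) x = 0 by rewrite gC.
have gIvu : g (I *m v) u = 0 by rewrite gIl gvIu oppr0.
have guIv : g u (I *m v) = 0 by rewrite gC.
pose U := nth 0 [:: u; I *m u; v; I *m v].
exists (\matrix_(i, j) U j i 0).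
have colU (j : 'I_4) : col j (\matrix_(i, k) U k i 0) = U j :> 'cV_4.
  by apply/matrixP => i k; rewrite !mxE ord1.
split; apply/matrixP => i j.
  have -> : ((\matrix_(i, j) U j i 0)^T *m G *m (\matrix_(i, j) U j i 0)) i j
            = g (U i) (U j).
    by rewrite /g -!colU tr_col -!row_mul -col_mul [in RHS]mxE [RHS]mxE.
  rewrite mxE; move: i j.
  by do 2!(apply: forall4);
     rewrite /U /= ?gI ?gII ?gII' ?gu ?gv ?gvu ?gvIu ?guv ?gIuv ?gIvu ?guIv.
transitivity ((I *m U j) i 0); first by rewrite -colU -col_mul [RHS]mxE.
rewrite [RHS]mxE sum4 ![in RHS]mxE; move: j.
by apply: forall4; rewrite /U /= ?II !mxE; ring.
Qed.

(** * The rational rotation attached to a polarization *)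

Lemma map_psi0 (K L : pzRingType) (f : {rmorphism K -> L}) (a b x y : K) :
  map_mx f (psi0 a b x y) = psi0 (f a) (f b) (f x) (f y).
Proof. by mx4; rewrite ?rmorphN ?rmorph0. Qed.

Lemma map_J4 (K L : pzRingType) (f : {rmorphism K -> L}) : map_mx f J4 = J4.
Proof. by mx4; rewrite ?rmorphN ?rmorph1 ?rmorph0. Qed.

Lemma invariant_anticommute (K : pzRingType) (I A : 'M[K]_4) :
  I *m I = - 1%:M -> I^T *m A *m I = A -> I^T *m A = - (A *m I).
Proof. by move=> hI hA; rewrite -{2}hA -mulmxA hI mulmxN mulmx1 opprK. Qed.

(** The derivation identity for I itself: [lie I] kills [A] and multiplies [S] by 2z, while I has
    trace 0, so 2z times the pairing vanishes. *)
Lemma wedge_pair_type_orth (K : numFieldType) (I A S : 'M[K]_4) (z : K) :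
  I *m I = - 1%:M -> \tr I = 0 -> I^T *m A *m I = A ->
  antisym S -> I^T *m S = z *: S -> z != 0 -> wedge_pair A S = 0.
Proof.
move=> hI trI hA aS hS z0.
have SI : S *m I = z *: S.
  have := congr1 trmx hS; rewrite trmx_mul trmxK linearZ /= aS mulNmx scalerN.
  exact: oppr_inj.
have lieA : lie I A = 0 by rewrite /lie (invariant_anticommute _ _ _ hI hA) addNr.
have := wedge_pair_derivation _ I A S.
rewrite -/(lie I A) -/(lie I S) lieA /lie hS SI -scalerDl trI mul0r.
have -> : wedge_pair 0 S = 0 by rewrite wedge_pair_expand !mxE; ring.
have := wedge_pair_linear _ A (z + z) S 0; rewrite addr0 => ->.
have -> : wedge_pair A 0 = 0 by rewrite wedge_pair_expand !mxE; ring.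
rewrite add0r addr0 => /eqP; rewrite mulf_eq0 -mulr2n mulrn_eq0 (negPf z0) /=.
by move/eqP.
Qed.

Lemma mul_inverse_sqrtN1 (K : fieldType) (j s p : K) :
  j * j = -1 -> s != 0 -> p != 0 -> j * - (s * p)^-1 = (j * s * p)^-1.
Proof.
move=> j2 s0 p0; have j0 : j != 0.
  by apply/eqP => e; have /eqP := j2; rewrite e mul0r eq_sym oppr_eq0 oner_eq0.
have -> : j * - (s * p)^-1 = - (j * j) * (j * s * p)^-1 by field; rewrite s0 p0 j0.
by rewrite j2 opprK mul1r.
Qed.

Lemma ratR_inj (R : realType) : injective (@ratR R).
Proof.
move=> A B /matrixP e; apply/matrixP => i j; have := e i j; rewrite !mxE.
exact: fmorph_inj.
Qed.

Section RationalPolarization.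
Variables (R : realType) (Gq psi : 'M[rat]_4) (I : 'M[R]_4).
Hypothesis posG : posdef (@ratR R Gq).
Hypothesis cplxI : cplx_struct I.
Hypothesis compG : compatible (ratR Gq) I.
Hypothesis anti : antisym psi.
Hypothesis psi11 : is11 I (ratR psi).
Hypothesis posI : posdef (I^T *m ratR psi).

Let M := invmx Gq *m psi.

Lemma metric_sym : Gq^T = Gq.
Proof. by apply: (ratR_inj R); rewrite ratR_T; case: posG. Qed.

Lemma metric_unit : Gq \in unitmx.
Proof.
have [P [+ _]] := adapted_basis R _ I posG cplxI compG.
rewrite -mulmxA => /mulmx1_unit[_]; rewrite unitmx_mul => /andP[].
by rewrite /ratR map_unitmx.
Qed.

Lemma metric_rotation : Gq *m M = psi.
Proof. by rewrite mulKVmx // metric_unit. Qed.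

Lemma rotation_trace : \tr M = 0.
Proof.
have : \tr M = - \tr M.
  rewrite -{1}mxtrace_tr trmx_mul anti trmx_inv metric_sym mulNmx raddfN /=.
  by rewrite mxtrace_mulC.
by move=> e; lra.
Qed.

(** Both the metric and psi satisfy I^T X = -X I; the signs cancel in G^-1 psi. *)
Lemma rotation_commute : I *m ratR M = ratR M *m I.
Proof.
have uG : @ratR R Gq \in unitmx by rewrite /ratR map_unitmx metric_unit.
apply: (can_inj (mulKmx uG)); rewrite !mulmxA -[ratR Gq *m ratR M]ratR_M metric_rotation.
have -> : ratR Gq *m I = - (I^T *m ratR Gq).
  by rewrite (invariant_anticommute _ _ _ cplxI compG) opprK.
rewrite mulNmx -mulmxA -ratR_M metric_rotation.
by rewrite (invariant_anticommute _ _ _ cplxI psi11) opprK.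
Qed.

(** The form is psi G^-1 psi G^-1 psi: three skew factors make it antisymmetric, and M^2 commutes
    with I, which keeps it of type (1,1). *)
Lemma calH2_cubic : calH2 I (psi *m (M *m M)).
Proof.
split.
  rewrite /antisym /M !trmx_mul anti trmx_inv metric_sym.
  by rewrite !(mulmxN, mulNmx) !mulmxA !opprK.
have cMM : ratR (M *m M) *m I = I *m ratR (M *m M).
  by rewrite ratR_M -mulmxA -rotation_commute mulmxA -rotation_commute mulmxA.
rewrite /is11 [ratR (psi *m _)]ratR_M -[LHS]mulmxA -[_ *m I]mulmxA cMM !mulmxA.
by rewrite psi11.
Qed.

(** In a basis [P] where the metric is the identity, the form psi and the endomorphism [M] have the
    same matrix, so [M] takes the shape [psi0]; [Q] is the inverse of [P]. *)
Lemma adapted_rotation :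
  exists (P Q : 'M[R]_4) (a b x y : R),
    [/\ Q *m P = 1%:M, Q *m I = J4 *m Q, Q *m ratR M = psi0 a b x y *m Q,
        0 < a + b & 0 < a * b - x ^+ 2 - y ^+ 2].
Proof.
have [P [hP IP]] := adapted_basis R _ I posG cplxI compG.
pose Q := P^T *m ratR Gq; have PQ : P *m Q = 1%:M by apply: mulmx1C.
have PI : P^T *m I^T = J4^T *m P^T by rewrite -!trmx_mul IP.
pose A := P^T *m ratR psi *m P.
have aA : antisym A.
  by rewrite /antisym /A !trmx_mul trmxK -ratR_T anti raddfN /= mulNmx mulmxN mulmxA.
have JA : J4^T *m A *m J4 = A.
  by rewrite /A !mulmxA -PI -!mulmxA -IP -{2}psi11 !mulmxA.
have posA : posdef (J4^T *m A).
  have -> : J4^T *m A = P^T *m (I^T *m ratR psi) *m P by rewrite /A !mulmxA -PI.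
  move: posI; move: (I^T *m ratR psi) => X [sX pX]; split.
    by rewrite !trmx_mul trmxK sX mulmxA.
  move=> u u0; have -> : u^T *m (P^T *m X *m P) *m u = (P *m u)^T *m X *m (P *m u).
    by rewrite trmx_mul !mulmxA.
  apply: pX; apply: contraNneq u0 => e.
  by rewrite -[u]mul1mx -hP -mulmxA e mulmx0.
have [a [b [x [y eA]]]] := psi0P R A aA JA.
rewrite eA in posA; have [s0 p0] := psi0_posdef R a b x y posA.
exists P, Q, a, b, x, y; split=> //.
  by rewrite -[LHS]mulmx1 -{1}PQ -!mulmxA (mulmxA I) IP !mulmxA hP mul1mx.
by rewrite -eA /A -!mulmxA PQ mulmx1 -ratR_M metric_rotation.
Qed.

End RationalPolarization.

(** * The Kähler form in rational (1,1)-classes, with real and reflex-field coefficients *)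

Theorem theorem4p5 (R : realType) (Gq Bq : 'M[rat]_4) (I : 'M[R]_4) :
  posdef (@ratR R Gq) -> antisym Bq ->
  cplx_struct I -> polarizable I -> compatible (@ratR R Gq) I ->
  (exists n (c : 'I_n -> R) (psi : 'I_n -> 'M[rat]_4),
     (forall k, calH2 I (psi k)) /\
     kahler I (@ratR R Gq) = \sum_(k < n) c k *: ratR (psi k)) /\
  (exists n (e : 'I_n -> R[i]) (psi : 'I_n -> 'M[rat]_4),
     (forall k, calH2 I (psi k)) /\ (forall k, reflex_field I (e k)) /\
     iC *: RC (kahler I (@ratR R Gq)) = lincombC e psi).
Proof.
move=> posG _ cplxI [psiz [antiz [psi11 posI]]] compG.
pose psi : 'M[rat]_4 := map_mx intr psiz.
have eR : intR psiz = ratR psi :> 'M[R]_4 by apply/matrixP => i j; rewrite !mxE ratr_int.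
rewrite eR in psi11 posI.
have anti : antisym psi by rewrite /antisym /psi map_trmx antiz map_mxN.
pose M := invmx Gq *m psi.
have trM : \tr M = 0 := rotation_trace _ _ _ posG anti.
have cIM : I *m ratR M = ratR M *m I := rotation_commute _ _ _ _ posG cplxI compG psi11.
have GM : Gq *m M = psi := metric_rotation _ _ _ _ posG cplxI compG.
have [P [Q [a [b [x [y []]]]]]] :=
  adapted_rotation _ _ _ _ posG cplxI compG anti psi11 posI.
rewrite -/M; set A := psi0 a b x y => QP QI QM s0 p0.
have PQ : P *m Q = 1%:M by apply: mulmx1C.
have eM : ratR M = P *m A *m Q by rewrite -mulmxA -QM mulmxA PQ mul1mx.
have eI : I = P *m J4 *m Q by rewrite -mulmxA -QI mulmxA PQ mul1mx.
pose s := a + b; pose p := a * b - x ^+ 2 - y ^+ 2; pose t := s ^+ 2 - 2 * p.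
have M2 : ratR (M *m M) = P *m (A *m A) *m Q.
  by rewrite ratR_M eM -!mulmxA (mulmxA Q) QP mul1mx.
have M4 : ratR (M *m M *m (M *m M)) = P *m (A *m A *m (A *m A)) *m Q.
  by rewrite ratR_M M2 -!mulmxA (mulmxA Q) QP mul1mx.
have trP (B : 'M[R]_4) : \tr (P *m B *m Q) = \tr B.
  by rewrite mxtrace_mulC mulmxA QP mul1mx.
have tr2 : ratr (\tr (M *m M)) = - (2 * t) :> R.
  by rewrite -(trace_map_mx (@ratr R)) -[map_mx _ _]/(ratR (M *m M)) M2 trP psi0_tr2.
have tr4 : ratr (\tr (M *m M *m (M *m M))) = 2 * t ^+ 2 - 4 * p ^+ 2 :> R.
  rewrite -(trace_map_mx (@ratr R)) -[map_mx _ _]/(ratR (M *m M *m (M *m M))) M4 trP.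
  exact: psi0_tr4.
have [tq et] : exists tq, ratr tq = t.
  exists (- \tr (M *m M) / 2).
  by rewrite rmorphM rmorphN fmorphV rmorph_nat /= tr2; field.
(* Solve tr M^4 = 2 t^2 - 4 p^2 for p^2; p itself may be irrational. *)
have [qq eq] : exists qq, ratr qq = p ^+ 2.
  exists (tq ^+ 2 / 2 - \tr (M *m M *m (M *m M)) / 4).
  rewrite rmorphB rmorphM rmorphXn rmorphM !fmorphV !rmorph_nat /= et tr4.
  by field.
have sp0 : s * p != 0 by rewrite mulf_neq0 ?lt0r_neq0.
(* The cubic relation for I divided by s p; the minus sign comes from omega = I^T G = -G I. *)
pose k2 := - (s * p)^-1; pose k1 := (t + p) * k2.
pose chi := psi *m (M *m M).
have ek : kahler I (ratR Gq) = k1 *: ratR psi + k2 *: ratR chi.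
  have eK : kahler I (ratR Gq) = - (ratR Gq *m I) by exact: invariant_anticommute.
  have cubic : (s * p) *: I = (p + t) *: ratR M + ratR (M *m (M *m M)).
    have -> : (s * p) *: I = P *m ((s * p) *: J4) *m Q.
      by rewrite -scalemxAr -scalemxAl -eI.
    rewrite psi0_cubic mulmxDr mulmxDl -scalemxAr -scalemxAl -eM; congr (_ + _).
    by rewrite ratR_M M2 eM !mulmxA -(mulmxA _ Q) QP mulmx1.
  rewrite eK -[I in LHS](scalerK sp0) cubic -scalemxAr mulmxDr -scalemxAr -!ratR_M.
  rewrite (mulmxA Gq M) GM -/chi scalerDr scalerA opprD -!scaleNr; congr (_ *: _ + _).
  by rewrite /k1 /k2; ring.
have hchi : calH2 I chi := calH2_cubic _ _ _ _ posG cplxI compG anti psi11.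
have hpsi : calH2 I psi by [].
have h2 (k : 'I_2) : calH2 I [:: psi; chi]`_k by case: k => -[|[|]].
split.
  exists 2%N, (fun k => [:: k1; k2]`_k), (fun k => [:: psi; chi]`_k); split=> //.
  by rewrite !big_ord_recl big_ord0 addr0.
(* The pullback of dz_1 /\ dz_2 to the original coordinates, a nonzero (2,0)-form. *)
pose S := (RC Q)^T *m sigma0 iC *m RC Q.
have aS : antisym S.
  by rewrite /antisym /S !trmx_mul trmxK sigma0_antisym mulNmx mulmxN mulmxA.
have IS : (RC I)^T *m S = iC *: S.
  rewrite /S !mulmxA -trmx_mul -RC_M QI RC_M trmx_mul [RC J4]map_J4.
  by rewrite -(mulmxA _ J4^T) sigma0_type ?mulr_iC // -scalemxAr -scalemxAl.
have S0 : S != 0.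
  apply/eqP => e; have : (RC P)^T *m S *m RC P = sigma0 iC.
    rewrite /S !mulmxA -trmx_mul -RC_M -mulmxA -RC_M QP.
    by rewrite [RC 1%:M]map_mx1 trmx1 mul1mx mulmx1.
  rewrite e mulmx0 mul0mx => /matrixP/(_ o0 o2)/eqP.
  by rewrite !mxE /= eq_sym oner_eq0.
have iC0 : iC != 0 :> R[i].
  by apply/eqP => e; have /eqP := mulr_iC R; rewrite e mul0r eq_sym oppr_eq0 oner_eq0.
have trI : \tr I = 0.
  by rewrite eI trP /mxtrace sum4 !mxE /= !addr0.
have orth xi : calH2 I xi -> wedge_pair (QC xi) S = 0.
  move=> [_ xi11]; apply: (wedge_pair_type_orth _ (RC I) _ _ iC) => //.
  - by rewrite -RC_M cplxI raddfN; congr (- _); exact: map_mx1.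
  - by rewrite [LHS](trace_map_mx (@toC R)) trI rmorph0.
  - by rewrite QC_ratR -RC_T -!RC_M xi11.
(* Orthogonality to the rational (1,1)-classes places [S] in the complexified transcendental
   lattice. *)
have [n [c [xi [txi eS]]]] := transc_lincombC _ _ _ aS orth.
have QMC : RC Q *m QC M = psi0 (toC a) (toC b) (toC x) (toC y) *m RC Q.
  by rewrite QC_ratR -RC_M QM RC_M [RC A]map_psi0.
pose alpha : R[i] := iC * toC s.
have lieS : lie (QC M) S = alpha *: S.
  have -> : lie (QC M) S =
      (RC Q)^T *m lie (psi0 (toC a) (toC b) (toC x) (toC y)) (sigma0 iC) *m RC Q.
    rewrite /lie mulmxDr mulmxDl /S !mulmxA -trmx_mul QMC trmx_mul ?mulmxA.
    by rewrite -(mulmxA _ (RC Q)) QMC !mulmxA.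
  by rewrite lie_psi0_sigma0 ?mulr_iC // -rmorphD -scalemxAr -scalemxAl.
have ealpha : hodge_eigenvalue R I n c xi alpha.
  exists (lie M); split; first exact: hodge_endo_lie.
  by rewrite lincombC_lie eS.
have reflexE lam : hodge_eigenvalue R I n c xi lam -> reflex_field I lam.
  move=> [f [hf ef]]; exists f; split=> //; exists n, c, xi.
  by move: ef; rewrite eS => ef; split=> //; split=> //; split=> //.
have toC0 z : z != 0 -> toC z != 0 :> R[i] by rewrite fmorph_eq0.
(* Here alpha = i s, so alpha^2 = -s^2 = -(t + 2p) with t and p^2 rational. *)
have [eV epV] : hodge_eigenvalue R I n c xi alpha^-1 /\
    hodge_eigenvalue R I n c xi (alpha * toC p)^-1.
  apply: (closed_inverses _ _ _ _ tq qq).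
  - exact: hodge_eigenvalueD.
  - exact: hodge_eigenvalueM.
  - exact: hodge_eigenvalue_rat.
  - exact: ealpha.
  - by rewrite mulf_neq0 // toC0 // lt0r_neq0.
  - by rewrite toC0 // lt0r_neq0.
  - by rewrite -rmorphXn -eq fmorph_rat.
  rewrite exprMn expr2 mulr_iC mulN1r -(fmorph_rat (@toC R)) et.
  by rewrite -rmorphXn -(rmorph_nat (@toC R) 2) -rmorphM -rmorphD /t subrK.
(* These are i k2 = -i/(s p) = 1/(alpha p) and i k1 = (t + p)/(alpha p) = 1/alpha + t/(alpha p). *)
pose e2 := (alpha * toC p)^-1; pose e1 := alpha^-1 + ratr tq * e2.
have he1 : hodge_eigenvalue R I n c xi e1.
  apply: hodge_eigenvalueD => //; apply: hodge_eigenvalueM => //.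
  exact: hodge_eigenvalue_rat.
exists 2%N, (fun k => [:: e1; e2]`_k), (fun k => [:: psi; chi]`_k); split=> //; split.
  by case=> -[|[|]] //= _; exact: reflexE.
have s0C : toC s != 0 by rewrite toC0 // lt0r_neq0.
have p0C : toC p != 0 by rewrite toC0 // lt0r_neq0.
have ke2 : iC * toC k2 = e2.
  rewrite /k2 rmorphN fmorphV rmorphM; exact: mul_inverse_sqrtN1 (mulr_iC R) s0C p0C.
have ke1 : iC * toC k1 = e1.
  rewrite /k1 rmorphM mulrCA ke2 rmorphD mulrDl -et fmorph_rat addrC; congr (_ + _).
  by rewrite /e2 invfM mulrC mulfVK.
rewrite ek raddfD /= !RC_Z scalerDr !scalerA ke1 ke2 -!QC_ratR.
by rewrite /lincombC !big_ord_recl big_ord0 addr0.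
Qed.
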